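(* Let $(\Omega,\mathcal{A},\mu)$ be a $\sigma$-finite measure space and let $X$ be a solid Banach function space on $\Omega$. Put $\mathcal{A}_0:=\{E\in\mathcal{A}:\ \mu(E)>0 \text{ and } \chi_E\in X\}$ and assume that $\inf\{\|\chi_E\|_X:\ E\in\mathcal{A}_0\}=0$. Then for all real numbers $p,q,r$ with $1\leq p<r$ and $1\leq q<r$, the set $\{(f,g)\in X^p\times X^q:\ fg\notin X^r\}$ is spaceable in $X^p\times X^q$.
   Context: $\mathcal{M}_0(\Omega)$ denotes the set of all $\mathcal{A}$-measurable complex-valued functions on $\Omega$, with functions that are equal $\mu$-almost everywhere identified. A linear subspace $X$ of $\mathcal{M}_0(\Omega)$ equipped with a norm $\|\cdot\|_X$ is called a Banach function space on $\Omega$ if $(X,\|\cdot\|_X)$ is a Banach space. It is called solid if for each $f\in X$ and $g\in\mathcal{M}_0(\Omega)$ with $|g|\leq|f|$ a.e. we have $g\in X$ and $\|g\|_X\leq\|f\|_X$. $\chi_E$ is the characteristic function of $E$. For $p\geq1$ and $f\in\mathcal{M}_0(\Omega)$ put $\|f\|_p:=\inf\{\lambda>0:\ (|f|/\lambda)^p\in X,\ \|(|f|/\lambda)^p\|_X\leq 1\}$ (with $\inf\varnothing=\infty$); $X^p$ is the set of all $f\in\mathcal{M}_0(\Omega)$ with $\|f\|_p<\infty$, and $(X^p,\|\cdot\|_p)$ is a Banach function space on $\Omega$. (Thus $f\in X^p$ iff $|f|^p\in X$, and then $\|f\|_p=\||f|^p\|_X^{1/p}$.) The product $X^p\times X^q$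 is the Banach space with any of the usual equivalent product norms. A subset $S$ of a Banach space $Y$ is called spaceable in $Y$ if $S\cup\{0\}$ contains a closed infinite-dimensional linear subspace of $Y$. *)

(* Defs.v *)
From HB Require Import structures.
From mathcomp Require Import all_boot all_order all_algebra complex.
From mathcomp Require Import all_classical all_reals all_analysis measurable_realfun.

Set Implicit Arguments.
Unset Strict Implicit.
Unset Printing Implicit Defensive.

Import Order.TTheory GRing.Theory Num.Theory.
Import numFieldNormedType.Exports ComplexField.

Local Open Scope classical_set_scope.
Local Open Scope ring_scope.
Local Open Scope complex_scope.

(* The modulus as an element of [R]; the library norm [`|z|] lies in [R[i]]. *)
Notation cabs := (@Normc.normc _).

(* The complex numbers with their Borel sigma-algebra. *)
Definition borelC (R : realType) :=
  g_sigma_algebraType (@open (R[i] : numFieldType)).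
HB.instance Definition _ (R : realType) := Measurable.on (borelC R).

Section complex_measurability.
Context (d : measure_display) (T : measurableType d) (R : realType).
Implicit Types f g : T -> R[i].

Definition cmeasurable f := measurable_fun [set: T] (f : T -> borelC R).

Lemma normCE (z : R[i]) : `|z| = (cabs z)%:C.
Proof. by case: z => a b; rewrite normc_def. Qed.

Lemma cabs_le (z : R[i]) : cabs z <= `|complex.Re z| + `|complex.Im z|.
Proof.
case: z => a b /=; rewrite -(@ger0_norm _ (`|a| + `|b|)) ?addr_ge0//.
rewrite -sqrtr_sqr ler_wsqrtr// sqrrD !real_normK ?num_real//.
rewrite lerD2r lerDl mulrn_wge0// mulr_ge0//.
Qed.

Lemma Re_le_cabs (z : R[i]) : `|complex.Re z| <= cabs z.
Proof.
by case: z => a b /=; rewrite -sqrtr_sqr ler_wsqrtr// lerDl sqr_ge0.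
Qed.

Lemma Im_le_cabs (z : R[i]) : `|complex.Im z| <= cabs z.
Proof.
by case: z => a b /=; rewrite -sqrtr_sqr ler_wsqrtr// lerDr sqr_ge0.
Qed.

Lemma open_borelC (U : set R[i]) :
  (forall z, U z -> exists2 e : R, 0 < e &
     forall w, cabs (z - w) < e -> U w) ->
  measurable (U : set (borelC R)).
Proof.
move=> Uo; apply: sub_sigma_algebra; rewrite openE => z /Uo [e e0 eU].
apply/nbhs_ballP; exists e%:C; first by rewrite /= ltcR.
by move=> w /=; rewrite -ball_normE /= normCE ltcR; apply: eU.
Qed.

Lemma measurable_ReIm : measurable_fun [set: borelC R] (@complex.Re R) /\
  measurable_fun [set: borelC R] (@complex.Im R).
Proof.
split; apply: (@measurability _ _ _ _ _ _ _ (RGenOInfty.measurableE R));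
  move=> _ [_ [x ->] <-]; rewrite setTI; apply: open_borelC => z /=;
  rewrite in_itv /= andbT => xz.
- exists (complex.Re z - x); first by rewrite subr_gt0.
  move=> w /(le_lt_trans (Re_le_cabs _)); rewrite raddfB /= in_itv/= andbT.
  by move=> /(le_lt_trans (ler_norm _)); rewrite ltrD2l ltrN2.
- exists (complex.Im z - x); first by rewrite subr_gt0.
  move=> w /(le_lt_trans (Im_le_cabs _)); rewrite raddfB /= in_itv/= andbT.
  by move=> /(le_lt_trans (ler_norm _)); rewrite ltrD2l ltrN2.
Qed.

Lemma cmeasurableP f : cmeasurable f <->
  measurable_fun [set: T] (fun x => complex.Re (f x)) /\
  measurable_fun [set: T] (fun x => complex.Im (f x)).
Proof.
have [mRe mIm] := measurable_ReIm; split=> [mf|[mr mi]].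
  by split; [exact: (measurableT_comp mRe mf)|exact: (measurableT_comp mIm mf)].
apply: (@measurability _ _ _ (borelC R) _ _ _ erefl) => _ [U oU <-].
rewrite setTI.
pose sq (q : (rat * rat) * (rat * rat)) := [set z : R[i] |
  [/\ ratr q.1.1 < complex.Re z, complex.Re z < ratr q.1.2,
      ratr q.2.1 < complex.Im z & complex.Im z < ratr q.2.2]].
have -> : f @^-1` U =
    \bigcup_q (if `[< sq q `<=` U >] then f @^-1` sq q else set0).
  apply/seteqP; split=> [x /= Ux|x [q _]]; last first.
    by case: ifPn => // /asboolP; apply.
  move: (oU); rewrite openE => /(_ _ Ux) /nbhs_ballP [e e0 eU].
  have [r r0 rU] : exists2 r : R, 0 < r & forall w, cabs (f x - w) < r -> U w.
    move: e e0 eU => [e e'] /=; rewrite ltcE /= => /andP[/eqP -> e0] eU.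
    exists e => // w fw; apply: eU => /=; rewrite -ball_normE /=.
    by rewrite normCE ltcR.
  have r2 : 0 < r / 2 by rewrite divr_gt0.
  have rat_near (y : R) : exists q : rat * rat,
      [/\ ratr q.1 < y, y < ratr q.2 & forall z, ratr q.1 < z -> z < ratr q.2 ->
        `|y - z| < r / 2].
    have [|a] := @rat_in_itvoo R (y - r / 2) y; first by rewrite gtrBl.
    have [|b] := @rat_in_itvoo R y (y + r / 2); first by rewrite ltrDl.
    rewrite !in_itv /= => /andP[yb by_] /andP[ay ya].
    exists (a, b); split => //= z az zb; rewrite ltr_distlC; apply/andP; split.
    - by apply: lt_trans az.
    - by apply: (lt_trans zb).
  have [q1 [q11 q12 q1P]] := rat_near (complex.Re (f x)).
  have [q2 [q21 q22 q2P]] := rat_near (complex.Im (f x)).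
  exists (q1, q2) => //; case: ifPn => [_|/asboolP[]]; first by split.
  move=> w [/= w1 w2 w3 w4]; apply: rU; apply: le_lt_trans (cabs_le _) _.
  by rewrite !raddfB /= (splitr r) ltrD ?q1P ?q2P.
apply: countable_bigcupT_measurable => [|q]; first exact: countableP.
case: ifPn => // _.
rewrite (_ : f @^-1` sq q =
  (fun x => complex.Re (f x)) @^-1` `]ratr q.1.1, ratr q.1.2[ `&`
  (fun x => complex.Im (f x)) @^-1` `]ratr q.2.1, ratr q.2.2[); last first.
  apply/seteqP; split => x /= [].
    by move=> ? ? ? ?; split; rewrite in_itv /=; apply/andP.
  by rewrite !in_itv => /= /andP[? ?] /andP[? ?].
by apply: measurableI; rewrite -[X in measurable X]setTI; [apply: mr|apply: mi].
Qed.

End complex_measurability.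

Section complex_measurability_ops.
Context (d : measure_display) (T : measurableType d) (R : realType).
Implicit Types f g : T -> R[i].

Lemma cmeasurableD f g : cmeasurable f -> cmeasurable g ->
  cmeasurable (fun x => f x + g x).
Proof.
move=> /cmeasurableP[fr fi] /cmeasurableP[gr gi]; apply/cmeasurableP.
split; under eq_fun do rewrite raddfD; exact: measurable_funD.
Qed.

Lemma cmeasurableM f g : cmeasurable f -> cmeasurable g ->
  cmeasurable (fun x => f x * g x).
Proof.
move=> /cmeasurableP[fr fi] /cmeasurableP[gr gi]; apply/cmeasurableP.
have mulE x : f x * g x =
    (complex.Re (f x) * complex.Re (g x) - complex.Im (f x) * complex.Im (g x))
    +i* (complex.Re (f x) * complex.Im (g x)
         + complex.Im (f x) * complex.Re (g x)).
  by case: (f x) (g x) => [a b] [a' b'].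
split; under eq_fun do rewrite mulE /=.
- by apply: measurable_funB; exact: measurable_funM.
- by apply: measurable_funD; exact: measurable_funM.
Qed.

Lemma cmeasurable_cst (z : R[i]) : cmeasurable (fun _ : T => z).
Proof. by apply/cmeasurableP; split; exact: measurable_cst. Qed.

Lemma cmeasurableN f : cmeasurable f -> cmeasurable (fun x => - f x).
Proof.
move=> mf; under eq_fun do rewrite -mulN1r.
exact: (cmeasurableM (cmeasurable_cst _) mf).
Qed.

Lemma cmeasurable_real (h : T -> R) : measurable_fun [set: T] h ->
  cmeasurable (fun x => (h x)%:C).
Proof. by move=> mh; apply/cmeasurableP; split => //; exact: measurable_cst. Qed.

Lemma measurable_cabs f : cmeasurable f ->
  measurable_fun [set: T] (fun x => cabs (f x)).
Proof.
move=> /cmeasurableP[fr fi].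
have cabsE x : cabs (f x) =
    Num.sqrt (complex.Re (f x) ^+ 2 + complex.Im (f x) ^+ 2).
  by case: (f x).
under eq_fun do rewrite cabsE.
apply: (@measurableT_comp _ _ _ _ _ _ (@Num.sqrt R)).
  by apply: continuous_measurable_fun; exact: sqrt_continuous.
by apply: measurable_funD; exact: measurable_funX.
Qed.

Lemma cmeasurable_pow (l p : R) f : cmeasurable f ->
  cmeasurable (fun x => ((cabs (f x) / l) `^ p)%:C).
Proof.
move=> mf; apply: cmeasurable_real; apply: (measurableT_comp (measurable_powR p)).
by apply: measurable_funM; [exact: measurable_cabs|exact: measurable_cst].
Qed.

Lemma cmeasurable_indic (E : set T) : measurable E ->
  cmeasurable (fun x => (\1_E x : R)%:C).
Proof. by move=> mE; exact/cmeasurable_real/measurable_indic. Qed.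

End complex_measurability_ops.

(* The space of measurable complex functions modulo equality mu-a.e. *)
Definition M0 (d : measure_display) (T : measurableType d) (R : realType)
  (mu : {measure set T -> \bar R}) : Type := {mfun_ mu, T >-> borelC R}.

Section M0_lmodule.
Context (d : measure_display) (T : measurableType d) (R : realType).
Context (mu : {measure set T -> \bar R}).
Local Notation M0 := (M0 mu).
Local Open Scope quotient_scope.

HB.instance Definition _ := Choice.on M0.
HB.instance Definition _ := EqQuotient.on M0.

(* A chosen representative. *)
Definition M0_fun (f : M0) : T -> R[i] := (repr f : {mfun T >-> borelC R}).
Coercion M0_fun : M0 >-> Funclass.

Lemma M0_measurable (f : M0) : cmeasurable f.
Proof. exact: (@measurable_funPT _ _ _ _ (repr f : {mfun T >-> borelC R})). Qed.

Definition M0_class (f : T -> R[i]) (mf : cmeasurable f) : M0 :=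
  \pi_(M0) (mfun_Sub (mem_set mf) : {mfun T >-> borelC R}).

Lemma M0_eqP (f g : M0) : f = g <-> \forall x \ae mu, f x = g x.
Proof.
split=> [->|fg]; first exact: aeW.
rewrite -[f]reprK -[g]reprK; apply/eqmodP/asboolP.
by apply: filterS fg => x + _.
Qed.

Lemma M0_classE (f : T -> R[i]) (mf : cmeasurable f) :
  \forall x \ae mu, M0_class mf x = f x.
Proof.
have /eqmodP/asboolP : repr (M0_class mf) =
  mfun_Sub (mem_set mf) %[mod {mfun_ mu, T >-> borelC R}] by rewrite reprK.
by apply: filterS => x /(_ I).
Qed.

Definition M0_zero : M0 := M0_class (@cmeasurable_cst _ T R (0 : R[i])).
Definition M0_add (f g : M0) : M0 :=
  M0_class (cmeasurableD (M0_measurable f) (M0_measurable g)).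
Definition M0_opp (f : M0) : M0 := M0_class (cmeasurableN (M0_measurable f)).
Definition M0_scale (a : R[i]) (f : M0) : M0 :=
  M0_class (cmeasurableM (@cmeasurable_cst _ T R a) (M0_measurable f)).
Definition M0_mul (f g : M0) : M0 :=
  M0_class (cmeasurableM (M0_measurable f) (M0_measurable g)).

Lemma M0_addE (f g : M0) : \forall x \ae mu, M0_add f g x = f x + g x.
Proof. exact: M0_classE. Qed.

Lemma M0_oppE (f : M0) : \forall x \ae mu, M0_opp f x = - f x.
Proof. exact: M0_classE. Qed.

Lemma M0_zeroE : \forall x \ae mu, M0_zero x = 0.
Proof. exact: M0_classE. Qed.

Lemma M0_scaleE (a : R[i]) (f : M0) :
  \forall x \ae mu, M0_scale a f x = a * f x.
Proof. exact: M0_classE. Qed.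

Lemma M0_mulE (f g : M0) : \forall x \ae mu, M0_mul f g x = f x * g x.
Proof. exact: M0_classE. Qed.

Lemma M0_addA : associative M0_add.
Proof.
move=> f g h; apply/M0_eqP; near=> x.
by rewrite (near (M0_addE f (M0_add g h)) x)// (near (M0_addE g h) x)//
  (near (M0_addE (M0_add f g) h) x)// (near (M0_addE f g) x)// addrA.
Unshelve. all: by end_near. Qed.

Lemma M0_addC : commutative M0_add.
Proof.
move=> f g; apply/M0_eqP; near=> x.
by rewrite (near (M0_addE f g) x)// (near (M0_addE g f) x)// addrC.
Unshelve. all: by end_near. Qed.

Lemma M0_add0 : left_id M0_zero M0_add.
Proof.
move=> f; apply/M0_eqP; near=> x.
by rewrite (near (M0_addE M0_zero f) x)// (near M0_zeroE x)// add0r.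
Unshelve. all: by end_near. Qed.

Lemma M0_addN : left_inverse M0_zero M0_opp M0_add.
Proof.
move=> f; apply/M0_eqP; near=> x.
by rewrite (near (M0_addE (M0_opp f) f) x)// (near (M0_oppE f) x)//
  (near M0_zeroE x)// addNr.
Unshelve. all: by end_near. Qed.

HB.instance Definition _ :=
  GRing.isZmodule.Build M0 M0_addA M0_addC M0_add0 M0_addN.

Lemma M0_scaleA a b (f : M0) : M0_scale a (M0_scale b f) = M0_scale (a * b) f.
Proof.
apply/M0_eqP; near=> x.
by rewrite (near (M0_scaleE a (M0_scale b f)) x)// (near (M0_scaleE b f) x)//
  (near (M0_scaleE (a * b) f) x)// mulrA.
Unshelve. all: by end_near. Qed.

Lemma M0_scale1 : left_id 1 M0_scale.
Proof.
move=> f; apply/M0_eqP; near=> x.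
by rewrite (near (M0_scaleE 1 f) x)// mul1r.
Unshelve. all: by end_near. Qed.

Lemma M0_scaleDr : right_distributive M0_scale +%R.
Proof.
move=> a f g; apply/M0_eqP; near=> x.
by rewrite (near (M0_scaleE a (f + g)) x)// (near (M0_addE f g) x)//
  (near (M0_addE (M0_scale a f) (M0_scale a g)) x)//
  (near (M0_scaleE a f) x)// (near (M0_scaleE a g) x)// mulrDr.
Unshelve. all: by end_near. Qed.

Lemma M0_scaleDl (f : M0) : {morph M0_scale^~ f : a b / a + b}.
Proof.
move=> a b; apply/M0_eqP; near=> x.
by rewrite (near (M0_scaleE (a + b) f) x)//
  (near (M0_addE (M0_scale a f) (M0_scale b f)) x)//
  (near (M0_scaleE a f) x)// (near (M0_scaleE b f) x)// mulrDl.
Unshelve. all: by end_near. Qed.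

HB.instance Definition _ := GRing.Zmodule_isLmodule.Build R[i] M0
  M0_scaleA M0_scale1 M0_scaleDr M0_scaleDl.

(* The class of [(|f| / l) ^ p]. *)
Definition M0_pow (l p : R) (f : M0) : M0 :=
  M0_class (cmeasurable_pow l p (M0_measurable f)).

Definition M0_indic (E : {E : set T | measurable E}) : M0 :=
  M0_class (@cmeasurable_indic _ T R _ (svalP E)).

End M0_lmodule.

(* In the following a subspace [Y] of a vector space [V] is normed by a
   function [nY] defined on all of [V], whose values outside [Y] are irrelevant. *)
Section normed_subspaces.
Context (R : realType) (V : lmodType R[i]).
Implicit Types (Y W S : set V) (nY : V -> R).

Definition linear_subspace W : Prop := W 0 /\
  forall (a : R[i]) (u v : V), W u -> W v -> W (a *: u + v).

Definition norm_on Y nY :=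
  [/\ forall f, Y f -> 0 <= nY f,
      forall f, Y f -> nY f = 0 -> f = 0,
      forall (a : R[i]) f, Y f -> nY (a *: f) = cabs a * nY f
    & forall f g, Y f -> Y g -> nY (f + g) <= nY f + nY g].

Definition complete_on Y nY := forall u : nat -> V, (forall n, Y (u n)) ->
  (forall e, 0 < e -> exists N, forall m n, (N <= m)%N -> (N <= n)%N ->
     nY (u m - u n) < e) ->
  exists2 f, Y f & (fun n => nY (u n - f)) @ \oo --> (0 : R).

Definition banach_on Y nY :=
  [/\ linear_subspace Y, norm_on Y nY & complete_on Y nY].

Definition closed_in Y nY W := forall (u : nat -> V) (f : V),
  (forall n, W (u n)) -> Y f ->
  (fun n => nY (u n - f)) @ \oo --> (0 : R) -> W f.

Definition finite_dimensional W := exists (n : nat) (b : 'I_n -> V),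
  (forall i, W (b i)) /\
  forall w, W w -> exists c : 'I_n -> R[i], w = \sum_(i < n) c i *: b i.

Definition spaceable Y nY S := exists W : set V,
  [/\ linear_subspace W, W `<=` Y, closed_in Y nY W,
      ~ finite_dimensional W & W `<=` S `|` [set 0]].

End normed_subspaces.

Section banach_function_spaces.
Context (d : measure_display) (T : measurableType d) (R : realType).
Context (mu : {measure set T -> \bar R}).
Local Notation M0 := (M0 mu).
Implicit Types (X : set M0) (nX : M0 -> R).

Definition banach_function_space X nX := banach_on X nX.

Definition solid X nX : Prop := forall f g : M0, X f ->
  (\forall x \ae mu, cabs (g x) <= cabs (f x)) -> X g /\ nX g <= nX f.

Definition A0 X : set {E : set T | measurable E} :=
  [set E | (0 < mu (sval E))%E /\ X (M0_indic mu E)].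

Definition pnorm X nX (p : R) (f : M0) : \bar R :=
  ereal_inf [set l%:E | l in [set l : R |
    [/\ 0 < l, X (M0_pow l p f) & nX (M0_pow l p f) <= 1]]].

Definition Xp X nX (p : R) : set M0 := [set f | (pnorm X nX p f < +oo)%E].

(* The product [X^p * X^q], with the maximum norm. *)
Definition Xprod X nX (p q : R) : set (M0 * M0)%type :=
  [set fg | Xp X nX p fg.1 /\ Xp X nX q fg.2].

Definition Xprod_norm X nX (p q : R) (fg : (M0 * M0)%type) : R :=
  Num.max (fine (pnorm X nX p fg.1)) (fine (pnorm X nX q fg.2)).

End banach_function_spaces.

(* Main.v *)
(* Choose sets E_n in A_0 whose norms decrease so fast that the indicator of the
   union of the later sets has norm at most |E_n| / 2; removing that union from
   E_n gives disjoint sets G_n of positive measure with norms a_n = |G_n| as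
   small as wished.  Let h = sum_n a_n^(-1/r) 1_{G_n}.  Since a_n^(1-p/r) and
   a_n^(1-q/r) are summable, h lies in X^p and X^q, whereas |h h|^r on G_n has
   norm a_n^(-1), which is unbounded.  Partition the indices into infinitely
   many infinite classes and let W consist of the (f, f) with f a constant
   multiple of h on each class.  If f is not 0, then f f is not in X^r, because
   already one class with a nonzero coefficient makes the norms unbounded.
   W is closed since a sequence converging in X^p has an a.e. convergent
   subsequence. *)
Require Import Defs.
From HB Require Import structures.
From mathcomp Require Import all_boot all_order all_algebra complex.
From mathcomp Require Import all_classical all_reals all_analysis.
From mathcomp Require Import measurable_realfun ring lra.

Set Implicit Arguments.
Unset Strict Implicit.
Unset Printing Implicit Defensive.

Import Order.TTheory GRing.Theory Num.Theory.
Import numFieldNormedType.Exports.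

Local Open Scope classical_set_scope.
Local Open Scope ring_scope.

(** * Inequalities for complex moduli and real powers *)

Section real_and_complex_numbers.
Context (R : realType).
Implicit Types (x : R) (z w : R[i]).

Lemma cabs_ge0 z : 0 <= cabs z.
Proof. by case: z => a b; exact: sqrtr_ge0. Qed.

Lemma cabsR x : cabs (x%:C)%C = `|x|.
Proof. by rewrite /= expr0n /= addr0 sqrtr_sqr. Qed.

Lemma cabsD z w : cabs (z + w) <= cabs z + cabs w.
Proof. exact: le_normcD. Qed.

Lemma cabsN z : cabs (- z) = cabs z.
Proof. exact: normcN. Qed.

Lemma cabsB z w : cabs (z - w) = cabs (w - z).
Proof. by rewrite -cabsN opprB. Qed.

Lemma cabs_eq0 z : (cabs z == 0) = (z == 0).
Proof.
by apply/eqP/eqP => [/Normc.eq0_normc//|->]; rewrite Normc.normc0.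
Qed.

Lemma cabs_sub_ge z w : cabs z - cabs w <= cabs (z - w).
Proof. by rewrite lerBlDr -{1}(subrK w z) cabsD. Qed.

Lemma sum_geometric_le (c : R) m n : 0 <= c ->
  \sum_(i < n) c / 2 ^+ (m + i) <= c * 2 / 2 ^+ m.
Proof.
move=> c0.
suff -> : \sum_(i < n) c / 2 ^+ (m + i) = c * 2 / 2 ^+ m - c * 2 / 2 ^+ (m + n).
  by rewrite gerBl divr_ge0// ?mulr_ge0// exprn_ge0.
elim: n => [|n IHn]; first by rewrite big_ord0 addn0 subrr.
rewrite big_ord_recr /= IHn addnS exprS.
have : (2 : R) ^+ m != 0 by rewrite expf_neq0.
have : (2 : R) ^+ (m + n) != 0 by rewrite expf_neq0.
by move: (_ ^+ (m + n)) (_ ^+ m) => y z y0 z0; field; rewrite y0 z0.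
Qed.

Lemma cvg_div_exp2 (c : R) : (fun n => c / 2 ^+ n) @ \oo --> (0 : R).
Proof.
rewrite -(mulr0 c); apply: cvgMl_tmp; under eq_fun do rewrite -exprVn.
by apply: cvg_expr; rewrite ger0_norm// invf_lt1// ltr1n.
Qed.

(** The sum is at most twice the larger term. This crude bound is what makes $X^p$ closed under
    addition. *)
Lemma powRD_le (p x y : R) : 0 <= p -> 0 <= x -> 0 <= y ->
  (x + y) `^ p <= 2 `^ p * (x `^ p + y `^ p).
Proof.
move=> p0; wlog xy : x y / x <= y.
  move=> wl x0 y0; case/orP: (le_total x y) => [|/wl]; first by move/wl; exact.
  by rewrite [y + x]addrC [_ + x `^ p]addrC; exact.
move=> x0 y0; apply: (@le_trans _ _ ((2 * y) `^ p)).
  by rewrite ge0_ler_powR ?nnegrE ?addr_ge0 ?mulr_ge0// mulr_natl mulr2n lerD2r.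
by rewrite powRM// ler_wpM2l ?powR_ge0// lerDr powR_ge0.
Qed.

(** Uniqueness of limits, in a form that carries a limit at one point of a block over to another
    point, [c] being the ratio of the values of $h$ there. *)
Lemma cabs_cvg_unique (z : nat -> R[i]) (c l m : R[i]) :
  (fun n => cabs (z n - l)) @ \oo --> (0 : R) ->
  (fun n => cabs (c * z n - m)) @ \oo --> (0 : R) -> m = c * l.
Proof.
move=> zl zm; apply/eqP; rewrite -subr_eq0 -cabs_eq0 eq_le cabs_ge0 andbT.
have := cvgD (cvgMl_tmp (a := cabs c) zl) zm.
rewrite mulr0 addr0 => /(_ _ _) cvg0.
apply: (cvgr_to_ge cvg0); apply: nearW => n.
change (cabs (m - c * l) <= cabs c * cabs (z n - l) + cabs (c * z n - m)).
rewrite -Normc.normcM [leRHS]addrC [cabs (c * z n - m)]cabsB.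
by apply: le_trans (cabsD _ _); rewrite mulrBr addrA subrK.
Qed.

End real_and_complex_numbers.

(** * Pointwise almost everywhere descriptions of the operations on classes *)

Section almost_everywhere_classes.
Context (d : measure_display) (T : measurableType d) (R : realType).
Context (mu : {measure set T -> \bar R}).
Local Notation M0 := (M0 mu).
Implicit Types (f g : M0) (x : T).

Lemma measurable_comp_nat (k : T -> nat) (phi : nat -> R) :
  (forall n, measurable (k @^-1` [set n])) ->
  measurable_fun setT (fun x => phi (k x)).
Proof.
move=> mk _ Y mY; rewrite setTI.
rewrite (_ : _ @^-1` _ = \bigcup_(n in phi @^-1` Y) k @^-1` [set n]).
  by apply: bigcup_measurable => n _; exact: mk.
by apply/seteqP; split=> [x Yx|x [n Yn /= ->]]//; exists (k x).
Qed.

Lemma M0D f g : \forall x \ae mu, M0_fun (f + g) x = f x + g x.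
Proof. exact: M0_addE. Qed.

Lemma M0Z (a : R[i]) f : \forall x \ae mu, M0_fun (a *: f) x = a * f x.
Proof. exact: M0_scaleE. Qed.

Lemma M0N f : \forall x \ae mu, M0_fun (- f) x = - f x.
Proof. exact: M0_oppE. Qed.

Lemma M00 : \forall x \ae mu, (0 : M0) x = 0.
Proof. exact: M0_zeroE. Qed.

Lemma M0B f g : \forall x \ae mu, M0_fun (f - g) x = f x - g x.
Proof. by apply: filterS2 (M0D f (- g)) (M0N g) => x -> ->. Qed.

Lemma M0_sum (I : Type) (s : seq I) (u : I -> M0) :
  \forall x \ae mu, M0_fun (\sum_(i <- s) u i) x = \sum_(i <- s) u i x.
Proof.
elim: s => [|i s IHs].
  by apply: filterS M00 => x; rewrite !big_nil.
apply: filterS2 IHs (M0D (u i) (\sum_(j <- s) u j)) => x IHx uE.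
by rewrite !big_cons uE IHx.
Qed.

(** Serves to read off coefficients by evaluating almost everywhere identities at a point of a set
    of positive measure. *)
Lemma ae_exists (E : set T) (P : T -> Prop) : measurable E ->
  (0 < mu E)%E -> (\forall x \ae mu, P x) -> exists2 x, E x & P x.
Proof.
move=> mE E0 [N [mN N0 PN]]; apply: contrapT => nEP.
suff : (mu E <= mu N)%E by rewrite N0 leNgt E0.
apply: le_measure; rewrite ?inE// => x Ex; apply: PN => /= Px.
by apply: nEP; exists x.
Qed.

Lemma M0_indicE (E : {E : set T | measurable E}) :
  \forall x \ae mu, M0_indic mu E x = ((\1_(sval E) x : R)%:C)%C.
Proof. exact: M0_classE. Qed.

Lemma M0_powE (l p : R) f :
  \forall x \ae mu, M0_pow l p f x = (((cabs (f x) / l) `^ p)%:C)%C.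
Proof. exact: M0_classE. Qed.

Lemma cabs_indicE (E : {E : set T | measurable E}) :
  \forall x \ae mu, cabs (M0_indic mu E x) = \1_(sval E) x.
Proof.
by apply: filterS (M0_indicE E) => x ->; rewrite cabsR ger0_norm.
Qed.

Lemma cabs_pow1E (p : R) f :
  \forall x \ae mu, cabs (M0_pow 1 p f x) = cabs (f x) `^ p.
Proof.
apply: filterS (M0_powE 1 p f) => x ->.
by rewrite cabsR ger0_norm ?powR_ge0// divr1.
Qed.

End almost_everywhere_classes.

(** * Solid Banach function spaces and series in them *)

Section solid_spaces.
Context (d : measure_display) (T : measurableType d) (R : realType).
Context (mu : {measure set T -> \bar R}).
Local Notation M0 := (M0 mu).
Context (X : set M0) (nX : M0 -> R).
Hypotheses (HX : banach_function_space X nX) (Hsolid : solid X nX).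
Implicit Types (f g : M0).

Let X0 : X 0. Proof. by case: HX => -[]. Qed.

Let XZD a f g : X f -> X g -> X (a *: f + g).
Proof. by case: HX => -[_ h _ _]; exact: h. Qed.

Lemma bfsD f g : X f -> X g -> X (f + g).
Proof. by move=> Xf Xg; rewrite -[f]scale1r; exact: XZD. Qed.

Lemma bfsZ a f : X f -> X (a *: f).
Proof. by move=> Xf; rewrite -[_ *: _]addr0; exact: XZD. Qed.

Lemma bfsN f : X f -> X (- f).
Proof. by rewrite -scaleN1r; exact: bfsZ. Qed.

Lemma bfsB f g : X f -> X g -> X (f - g).
Proof. by move=> Xf Xg; rewrite addrC -scaleN1r; exact: XZD. Qed.

Lemma bfs_sum (u : nat -> M0) n : (forall i, X (u i)) -> X (\sum_(i < n) u i).
Proof.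
move=> Xu; elim: n => [|n IHn]; first by rewrite big_ord0.
by rewrite big_ord_recr /=; exact: bfsD.
Qed.

Lemma bfs_ge0 f : X f -> 0 <= nX f.
Proof. by case: HX => _ [h _ _ _] _; exact: h. Qed.

Lemma bfs_eq0 f : X f -> nX f = 0 -> f = 0.
Proof. by case: HX => _ [_ h _ _] _; exact: h. Qed.

Lemma bfs_normZ a f : X f -> nX (a *: f) = cabs a * nX f.
Proof. by case: HX => _ [_ _ h _] _; exact: h. Qed.

Lemma bfs_normD f g : X f -> X g -> nX (f + g) <= nX f + nX g.
Proof. by case: HX => _ [_ _ _ h] _; exact: h. Qed.

Lemma bfs_normN f : X f -> nX (- f) = nX f.
Proof. by move=> Xf; rewrite -scaleN1r bfs_normZ// cabsN Normc.normc1 mul1r. Qed.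

Lemma bfs_norm0 : nX 0 = 0.
Proof. by rewrite -(scale0r (0 : M0)) bfs_normZ// Normc.normc0 mul0r. Qed.

Lemma bfs_norm_sum (u : nat -> M0) n : (forall i, X (u i)) ->
  nX (\sum_(i < n) u i) <= \sum_(i < n) nX (u i).
Proof.
move=> Xu; elim: n => [|n IHn]; first by rewrite !big_ord0 bfs_norm0.
rewrite !big_ord_recr /=; apply: le_trans (bfs_normD _ _) _ => //.
  exact: bfs_sum.
by rewrite lerD2r.
Qed.

Lemma bfs_indic_gt0 (E : {E : set T | measurable E}) : (0 < mu (sval E))%E ->
  X (M0_indic mu E) -> 0 < nX (M0_indic mu E).
Proof.
move=> E0 XE; rewrite lt0r bfs_ge0// andbT; apply/eqP => /(bfs_eq0 XE) E00.
have [x Ex] := ae_exists (svalP E) E0 (filterI (M0_indicE mu E) (M00 mu)).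
rewrite E00 => -[-> /(congr1 (@complex.Re R))] /=.
by rewrite indicE mem_set//= => /eqP; rewrite oner_eq0.
Qed.

(* Riesz-Fischer, in a lattice form: the partial sums of the moduli are
   dominated pointwise by the modulus of their limit in norm. *)
Lemma dominated_series (u : nat -> M0) (c : R) : 0 <= c ->
  (forall i, X (u i)) -> (forall i, nX (u i) <= c / 2 ^+ i) ->
  exists S, [/\ X S, nX S <= c * 2 &
    \forall x \ae mu, forall n, \sum_(i < n) cabs (u i x) <= cabs (S x)].
Proof.
move=> c0 Xu uc.
pose v i : M0 := M0_class mu (cmeasurable_real (measurable_cabs (M0_measurable (u i)))).
have vE : \forall x \ae mu, forall i, v i x = ((cabs (u i x))%:C)%C.
  by apply: ae_foralln => i; exact: M0_classE.
have cvE i : \forall x \ae mu, cabs (v i x) <= cabs (u i x).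
  apply: filterS vE => x ->.
  by rewrite cabsR ger0_norm// cabs_ge0.
have Xv i : X (v i) by have [] := Hsolid (Xu i) (cvE i).
have vc i : nX (v i) <= c / 2 ^+ i.
  by have [_ /le_trans] := Hsolid (Xu i) (cvE i); exact.
pose s n := \sum_(i < n) v i.
have Xs n : X (s n) by exact: bfs_sum.
have sB m k : nX (s (m + k)%N - s m) <= c * 2 / 2 ^+ m.
  rewrite /s big_split_ord /= addrAC subrr add0r.
  apply: le_trans (bfs_norm_sum (u := fun i => v (m + i)%N) _ _) _ => //.
  apply: le_trans (sum_geometric_le m k c0).
  by apply: ler_sum => i _.
have [S XS sS] : exists2 S : M0, X S & (fun n => nX (s n - S)) @ \oo --> (0 : R).
  case: HX => _ _; apply => // e e0.
  have /cvgrPdist_lt/(_ e e0)[N _ NP] := cvg_div_exp2 (c * 2).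
  exists N => m n Nm Nn; wlog mn : m n Nm Nn / (m <= n)%N.
    move=> wl; case/orP: (leq_total m n); first exact: wl.
    by move=> /(wl _ _ Nn Nm); rewrite -opprB bfs_normN//; exact: bfsB.
  rewrite -opprB bfs_normN; last exact: bfsB.
  rewrite -(subnKC mn); apply: le_lt_trans (sB _ _) _.
  move: (NP m Nm) => /=; rewrite sub0r normrN ger0_norm//.
  by rewrite divr_ge0 ?mulr_ge0// exprn_ge0.
exists S; split => //.
  (* The bound holds for every partial sum and passes to the limit. *)
  have h n : nX S <= c * 2 + nX (s n - S).
    rewrite [X in nX X <= _](_ : S = s n + - (s n - S)); last first.
      by rewrite opprB addrC subrK.
    apply: le_trans (bfs_normD (Xs n) (bfsN (bfsB (Xs n) XS))) _.
    rewrite bfs_normN ?lerD2r; last exact: bfsB.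
    by have := sB 0%N n; rewrite /s big_ord0 subr0 expr0 divr1.
  rewrite -[_ * _]addr0; apply: (cvgr_to_ge (cvgD (cvg_cst (c * 2)) sS)).
  by near=> n; exact: h.
apply: ae_foralln => n.
(* [w] is the positive part of the [n]-th partial sum minus $|S|$. For every $m \geq n$ it is
   dominated by $|s_m - S|$, whose norm tends to 0, so [w] vanishes. *)
have mw : measurable_fun setT
    ((fun x => \sum_(i < n) cabs (u i x) - cabs (S x)) \max (fun=> 0)).
  apply: measurable_maxr => //; apply: measurable_funB.
    by apply: measurable_sum => i; apply: measurable_cabs; exact: M0_measurable.
  by apply: measurable_cabs; exact: M0_measurable.
pose w : M0 := M0_class mu (cmeasurable_real mw).
have wE : \forall x \ae mu,
    w x = ((Num.max (\sum_(i < n) cabs (u i x) - cabs (S x)) 0)%:C)%C.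
  exact: M0_classE.
have cvE' : \forall x \ae mu, forall m,
    M0_fun (s m) x = ((\sum_(i < m) cabs (u i x))%:C)%C.
  apply: ae_foralln => m.
  apply: filterS2 vE (M0_sum (index_enum 'I_m) (fun i => v i)) => x vx sx.
  by rewrite /s sx rmorph_sum/=; apply: eq_bigr => i _.
have ws m : (n <= m)%N -> \forall x \ae mu, cabs (w x) <=
    cabs (M0_fun (s m - S) x).
  move=> nm; apply: filterS3 wE cvE' (M0B (s m) S) => x -> sx ->.
  rewrite cabsR ger0_norm ?le_max ?lexx ?orbT// ge_max cabs_ge0 andbT.
  apply: le_trans (cabs_sub_ge _ _); rewrite lerD2r sx cabsR.
  apply: le_trans (ler_norm _); rewrite -(subnKC nm) big_split_ord /=.
  by rewrite lerDl sumr_ge0// => i _; exact: cabs_ge0.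
have Xw : X w by have [] := Hsolid (bfsB (Xs n) XS) (ws n (leqnn n)).
have /(bfs_eq0 Xw) w0 : nX w = 0.
  apply/eqP; rewrite eq_le bfs_ge0// andbT.
  apply: (cvgr_to_ge sS); near=> m.
  have nm : (n <= m)%N by near: m; exact: nbhs_infty_ge.
  by have [] := Hsolid (bfsB (Xs m) XS) (ws m nm).
move: wE; rewrite w0 => wE.
apply: filterS2 wE (M00 mu) => x -> /(congr1 (@complex.Re R)) /= /eqP.
by rewrite eq_le => /andP[+ _]; rewrite ge_max subr_le0 => /andP[].
Unshelve. all: by end_near. Qed.


(** * Disjoint sets of positive measure and small norm *)

(** The disjoint family is encoded by a labelling [k]: the fiber over [n.+1] is the [n]-th set, and
    the label 0 is left for the points outside all of them. *)
Lemma exists_disjoint_small_sets (delta : nat -> R) :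
  (forall n, 0 < delta n) ->
  ereal_inf [set (nX (M0_indic mu E))%:E | E in A0 X] = 0%E ->
  exists (k : T -> nat) (mk : forall n, measurable (k @^-1` [set n])),
  forall n, [/\ (0 < mu (k @^-1` [set n.+1]))%E,
    X (M0_indic mu (exist measurable _ (mk n.+1))) &
    nX (M0_indic mu (exist measurable _ (mk n.+1))) <= delta n].
Proof.
move=> delta0 Hinf.
have ex e : 0 < e -> exists2 E, A0 X E & nX (M0_indic mu E) < e.
  move=> e0; have : (ereal_inf [set (nX (M0_indic mu E))%:E | E in A0 X] < e%:E)%E.
    by rewrite Hinf lte_fin.
  by move=> /ereal_inf_lt[_ [E XE <-]]; rewrite lte_fin => ?; exists E.
(* For [e <= 0] the value of [pick] is an arbitrary default. *)
have [|pick pickP] := @boolp.choice _ _ (fun e E => 0 < e ->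
    A0 X E /\ nX (M0_indic mu E) < e).
  move=> e.
  have [e0|e0] := pselect (0 < e).
    by have [E ? ?] := ex _ e0; exists E.
  by have [E _ _] := ex _ ltr01; exists E.
(* The factor 1/4 makes the norms of all sets after [E n] add up to at most half the norm of
   [E n]. *)
pose E := fix E n := if n is m.+1
  then pick (Num.min (delta n) (nX (M0_indic mu (E m)) / 4))
  else pick (delta 0%N).
pose a n := nX (M0_indic mu (E n)).
have EP n : A0 X (E n) /\ a n <= delta n.
  elim: n => [|n [[En XEn] _]].
    by have [? /ltW] := pickP _ (delta0 0%N).
  have /pickP[A0E] : 0 < Num.min (delta n.+1) (nX (M0_indic mu (E n)) / 4).
    by rewrite lt_min delta0 divr_gt0//; exact: bfs_indic_gt0.
  by rewrite lt_min => /andP[aE _]; split; [exact: A0E|exact: ltW].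
have a0 n : 0 < a n by have [[? ?] _] := EP n; exact: bfs_indic_gt0.
have a4 n : a n.+1 <= a n / 4.
  have /pickP[_] : 0 < Num.min (delta n.+1) (nX (M0_indic mu (E n)) / 4).
    by rewrite lt_min delta0 divr_gt0//; exact: a0.
  by rewrite lt_min => /andP[_ /ltW].
have adecay n i : a (n.+1 + i)%N <= a n / 4 / 2 ^+ i.
  elim: i => [|i IHi]; first by rewrite addn0 expr0 divr1.
  rewrite addnS; apply: le_trans (a4 _) _.
  apply: (@le_trans _ _ (a n / 4 / 2 ^+ i / 4)); first by rewrite ler_pM2r.
  rewrite exprS invfM mulrA [leRHS]mulrAC.
  have : 0 < a n / 4 / 2 ^+ i by rewrite !divr_gt0 ?exprn_gt0.
  by move: (a n / 4 / 2 ^+ i) => y; lra.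
pose F n := sval (E n) `\` \bigcup_i sval (E (n.+1 + i)%N).
have mF n : measurable (F n).
  apply: measurableD; first exact: svalP.
  by apply: bigcupT_measurable => i; exact: svalP.
(* Off [F n], the indicator of [E n] is dominated by the tail series, whose
   norm is at most [a n / 2]. *)
have F0 n : (0 < mu (F n))%E.
  rewrite lt0e measure_ge0 andbT; apply/eqP => F0.
  have nF : \forall x \ae mu, ~ F n x.
    by exists (F n); split => // x /contrapT.
  have an4 : 0 <= a n / 4 by rewrite divr_ge0// ltW.
  have [||S [XS Sa uS]] := dominated_series
    (u := fun i => M0_indic mu (E (n.+1 + i)%N)) an4.
  - by move=> i; have [[]] := EP (n.+1 + i)%N.
  - exact: adecay.
  have indE : \forall x \ae mu, forall i,
      cabs (M0_indic mu (E i) x) = \1_(sval (E i)) x.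
    by apply: ae_foralln => i; exact: cabs_indicE.
  have ES : \forall x \ae mu, cabs (M0_indic mu (E n) x) <= cabs (S x).
    apply: filterS3 nF uS indE => x nFx Sx Ex; rewrite Ex indicE.
    case: (boolP (x \in sval (E n))) => [|_]; last exact: cabs_ge0.
    rewrite inE => Enx.
    have [i _ xi] : (\bigcup_i sval (E (n.+1 + i)%N)) x.
      by apply: contrapT => nx; apply: nFx.
    apply: le_trans (Sx i.+1); rewrite big_ord_recr.
    have := Ex (n.+1 + i)%N; rewrite indicE mem_set// => /= ->.
    by rewrite lerDr sumr_ge0// => j _; exact: cabs_ge0.
  have [_ /le_trans/(_ Sa)] := Hsolid XS ES.
  by rewrite -/(a n); have := a0 n; lra.
have Fdisj n m x : F n x -> F m x -> n = m.
  wlog nm : n m / (n < m)%N.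
    move=> wl Fn Fm; have [/wl->//|/wl <-//|//] := ltngtP n m.
  move=> [_ nE] [Em _]; exfalso; apply: nE; exists (m - n.+1)%N => //.
  by rewrite subnKC.
pose k x := if pselect (exists n, F n x) is left h
  then (projT1 (cid h)).+1 else 0%N.
have kF n : k @^-1` [set n.+1] = F n.
  apply/seteqP; split=> x; rewrite /preimage/= /k; case: pselect => //.
    by move=> h [<-]; case: cid.
  - by move=> h Fx; case: cid => m /= /Fdisj -/(_ _ Fx) ->.
  - by move=> + Fx => -[]; exists n.
have mk n : measurable (k @^-1` [set n]).
  case: n => [|n]; last by rewrite kF.
  rewrite (_ : _ @^-1` _ = ~` \bigcup_n F n).
    by apply: measurableC; exact: bigcupT_measurable.
  apply/seteqP; split=> x; rewrite /preimage/= /k; case: pselect => //.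
  - by move=> nF _ [n _ Fx]; apply: nF; exists n.
  - by move=> [n Fx] nF; exfalso; apply: nF; exists n.
exists k, mk => n; rewrite {1}kF.
have [[_ XE] aE] := EP n.
set G := exist _ _ _.
have [|XG aG] := Hsolid (g := M0_indic mu G) XE; last first.
  by split => //; exact: le_trans aE.
apply: filterS2 (cabs_indicE mu (E n)) (cabs_indicE mu G) => x -> -> /=.
rewrite kF !indicE ler_nat; case: (boolP (x \in F n)) => //.
by rewrite inE => -[Ex _]; rewrite mem_set.
Qed.

(** * The spaces $X^p$ *)

(** Homogeneity of the power reduces every scale [l] in the definition of the $p$-norm to the scale
    1. *)
Lemma M0_powZ (l p : R) f : 0 < l ->
  M0_pow 1 p f = ((l `^ p)%:C)%C *: M0_pow l p f.
Proof.
move=> l0; apply/M0_eqP.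
apply: filterS3 (M0_powE 1 p f) (M0Z ((l `^ p)%:C)%C (M0_pow l p f)) (M0_powE l p f).
move=> x -> -> ->; rewrite -rmorphM /=; congr (_%:C)%C.
have l0' := ltW l0; rewrite divr1 -powRM// ?divr_ge0 ?cabs_ge0//.
by rewrite mulrC divfK ?gt_eqF.
Qed.

Lemma XpE (p : R) f : 1 <= p -> Xp X nX p f <-> X (M0_pow 1 p f).
Proof.
move=> p1; split.
  move=> /ereal_inf_lt[_ [l [l0 Xl _] <-] _].
  by rewrite (M0_powZ _ _ l0); exact: bfsZ.
(* The scale $N+1$ is admissible because $N \leq N+1 \leq (N+1)^p$; the added 1 keeps it
   positive. *)
move=> Xf; pose N := nX (M0_pow 1 p f).
have N0 : 0 <= N by exact: bfs_ge0.
have l0 : 0 < N + 1 by rewrite ltr_wpDl.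
have lp0 : 0 < (N + 1) `^ p by exact: powR_gt0.
have E : M0_pow (N + 1) p f = (((N + 1) `^ p)^-1%:C)%C *: M0_pow 1 p f.
  rewrite (M0_powZ _ _ l0) scalerA -rmorphM/= mulVf ?gt_eqF//.
  by rewrite scale1r.
apply: (@le_lt_trans _ _ (N + 1)%:E); last exact: ltry.
apply: ereal_inf_lbound; exists (N + 1) => //; split => //.
  by rewrite E; exact: bfsZ.
rewrite E bfs_normZ// cabsR ger0_norm ?invr_ge0 ?(ltW lp0)//.
rewrite ler_pdivrMl// mulr1; apply: (@le_trans _ _ (N + 1)).
  by rewrite lerDl.
by rewrite le1r_powR// lerDr.
Qed.

(** Some admissible scale [l] lies below [e], and $l^p \leq l$ since $l \leq 1 \leq p$. *)
Lemma pnorm_lt (p e : R) f : 1 <= p -> Xp X nX p f ->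
  fine (pnorm X nX p f) < e -> e <= 1 -> nX (M0_pow 1 p f) <= e.
Proof.
move=> p1 Xf fe e1.
have : (pnorm X nX p f < e%:E)%E.
  rewrite -[pnorm _ _ _ _]fineK ?lte_fin// fin_numElt Xf andbT.
  apply: lt_le_trans (ltNyr 0) _; apply: le_ereal_inf_tmp => _ [l [l0 _ _] <-].
  by rewrite lee_fin ltW.
move=> /ereal_inf_lt[_ [l [l0 Xl l1] <-]]; rewrite lte_fin => le.
rewrite (M0_powZ _ _ l0) bfs_normZ// cabsR ger0_norm ?powR_ge0//.
apply: (@le_trans _ _ (l `^ p)); first by rewrite ler_piMr// powR_ge0.
apply: le_trans (ltW le); apply: ge1r_powR => //; rewrite l0/=.
by rewrite (le_trans (ltW le)).
Qed.

Lemma Xp_solid (p : R) f g : 1 <= p -> Xp X nX p f ->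
  (\forall x \ae mu, cabs (g x) <= cabs (f x)) -> Xp X nX p g.
Proof.
move=> p1 /(XpE _ p1) Xf gf; apply/(XpE _ p1).
have [] := Hsolid (g := M0_pow 1 p g) Xf; last by [].
apply: filterS3 (cabs_pow1E p f) (cabs_pow1E p g) gf => x -> -> gfx.
by rewrite ge0_ler_powR ?nnegrE ?cabs_ge0// (le_trans ler01).
Qed.

Lemma XpZD (p : R) a f g : 1 <= p ->
  Xp X nX p f -> Xp X nX p g -> Xp X nX p (a *: f + g).
Proof.
move=> p1 /(XpE _ p1) Xf /(XpE _ p1) Xg; apply/(XpE _ p1).
have p0 : 0 <= p by rewrite (le_trans ler01).
(* An element of $X$ that dominates $|af+g|^p$; solidity then gives the claim. *)
pose G : M0 := ((2 `^ p)%:C)%C *: (((cabs a `^ p)%:C)%C *: M0_pow 1 p f +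
  M0_pow 1 p g).
have XG : X G by apply: bfsZ => //; apply: bfsD => //; exact: bfsZ.
have [] := Hsolid (g := M0_pow 1 p (a *: f + g)) XG; last by [].
have GE : \forall x \ae mu,
    G x = ((2 `^ p * (cabs a `^ p * cabs (f x) `^ p + cabs (g x) `^ p))%:C)%C.
  have h1 := M0Z (((cabs a `^ p)%:C)%C) (M0_pow 1 p f).
  have h2 := M0D (((cabs a `^ p)%:C)%C *: M0_pow 1 p f) (M0_pow 1 p g).
  have h3 := M0Z (((2 `^ p)%:C)%C)
    (((cabs a `^ p)%:C)%C *: M0_pow 1 p f + M0_pow 1 p g).
  apply: filterS3 (filterI h1 h2) (filterI h3 (M0_powE 1 p f)) (M0_powE 1 p g).
  move=> x [e1 e2] [e3 e4] e5; rewrite /G e3 e2 e1 e4 e5 !divr1.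
  by rewrite -rmorphM -rmorphD -rmorphM.
have afgE : \forall x \ae mu, M0_fun (a *: f + g) x = a * f x + g x.
  by apply: filterS2 (M0D (a *: f) g) (M0Z a f) => x -> ->.
apply: filterS3 GE afgE (cabs_pow1E p (a *: f + g)) => x Gx fgx ->.
rewrite Gx cabsR fgx; apply: le_trans (ler_norm _).
rewrite -powRM ?cabs_ge0//; apply: le_trans (powRD_le _ _ _);
  rewrite ?mulr_ge0 ?cabs_ge0//.
rewrite ge0_ler_powR ?nnegrE ?addr_ge0 ?mulr_ge0 ?cabs_ge0//.
by rewrite -Normc.normcM cabsD.
Qed.

Lemma Xp0 (p : R) : 1 <= p -> Xp X nX p 0.
Proof.
move=> p1; apply/(XpE _ p1).
rewrite (_ : M0_pow _ _ _ = 0)//; apply/M0_eqP.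
apply: filterS2 (M0_powE 1 p (0 : M0)) (M00 mu) => x -> ->.
by rewrite Normc.normc0 mul0r powR0// gt_eqF// (lt_le_trans ltr01).
Qed.

Lemma XpB (p : R) f g : 1 <= p -> Xp X nX p f -> Xp X nX p g ->
  Xp X nX p (f - g).
Proof. by move=> p1 Xf Xg; rewrite addrC -scaleN1r; exact: XpZD. Qed.

(** The $|v_n|^p$ have norms at most $2^{-n}$ in $X$, so almost everywhere their sum is finite and
    its terms tend to 0. *)
Lemma ae_cvg_of_fast_pnorm_cvg (p : R) (v : nat -> M0) : 1 <= p ->
  (forall n, Xp X nX p (v n)) ->
  (forall n, fine (pnorm X nX p (v n)) < 1 / 2 ^+ n) ->
  \forall x \ae mu, (fun n => cabs (v n x)) @ \oo --> (0 : R).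
Proof.
move=> p1 Xv v2; have p0 : 0 < p by rewrite (lt_le_trans ltr01).
have [|n|S [_ _ vS]] := dominated_series (u := fun n => M0_pow 1 p (v n)) ler01.
- by move=> n; apply/XpE.
- apply: pnorm_lt => //.
  by rewrite ler_pdivrMr ?exprn_gt0// mul1r -natrX ler1n expn_gt0.
have vE : \forall x \ae mu, forall n,
    cabs (M0_pow 1 p (v n) x) = cabs (v n x) `^ p.
  by apply: ae_foralln => n; exact: cabs_pow1E.
apply: filterS2 vS vE => x Sx vx.
have : cvgn (series (fun n => cabs (v n x) `^ p)).
  apply: nondecreasing_is_cvgn.
    apply/nondecreasing_seqP => n; rewrite /series/= big_nat_recr//=.
    by rewrite lerDl powR_ge0.
  exists (cabs (S x)) => _ [n _ <-]; rewrite /series/= big_mkord.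
  by apply: le_trans (Sx n); under eq_bigr do rewrite -vx.
move=> /cvg_series_cvg_0/cvgrPdist_lt cv; apply/cvgrPdist_lt => e e0.
have [N _ NP] := cv (e `^ p) (powR_gt0 _ e0); exists N => // n /NP /=.
rewrite !sub0r !normrN !ger0_norm ?powR_ge0 ?cabs_ge0//.
apply: contraTT; rewrite -!leNgt => ev.
by rewrite ge0_ler_powR ?nnegrE ?cabs_ge0// ltW.
Qed.

(** * The subspace of blockwise constant multiples of $h$ *)

Section block_constant_multiples.
Variables (p q r : R).
Hypotheses (p1 : 1 <= p) (pr : p < r) (q1 : 1 <= q).
Variables (k : T -> nat) (mk : forall n, measurable (k @^-1` [set n])).

Let G n : {E : set T | measurable E} := exist measurable _ (mk n).
Let a n := nX (M0_indic mu (G n)).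

Hypothesis k0 : forall n, (0 < mu (k @^-1` [set n.+1]))%E.
Hypothesis kX : forall n, X (M0_indic mu (G n.+1)).
(** These three bounds serve, in order, to keep $ff$ out of $X^r$, to put $h$ into $X^p$ and to put
    $h$ into $X^q$. *)
Hypothesis a_le : forall n, a n.+1 <= 1 / 2 ^+ n.
Hypothesis ap : forall n, a n.+1 `^ (1 - p / r) <= 1 / 2 ^+ n.
Hypothesis aq : forall n, a n.+1 `^ (1 - q / r) <= 1 / 2 ^+ n.

Let a0 n : 0 < a n.+1. Proof. exact: (@bfs_indic_gt0 (G n.+1) (k0 n) (kX n)). Qed.

Let r0 : 0 < r. Proof. by apply: lt_trans pr; rewrite (lt_le_trans ltr01). Qed.

(** The value of $h$ on the fiber over [n]. The value 0 at 0 matters: [logn 2 0 = 0] formally puts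
    the fiber over 0 into block 0. *)
Let phi n := if n is m.+1 then a n `^ (- r^-1) else 0.

Let phi_gt0 n : (0 < n)%N -> 0 < phi n.
Proof. by case: n => // n _; exact: powR_gt0. Qed.

Let phi_ge0 n : 0 <= phi n.
Proof. by case: n => // n; exact: powR_ge0. Qed.

Let h : M0 :=
  M0_class mu (cmeasurable_real (measurable_comp_nat phi mk)).

(** $|h|^s$ is a sum of multiples of disjoint indicators whose norms are $a_n^{1-s/r}$, so the
    dominated series applies; at each point a single term suffices. *)
Let Xp_h (s : R) : 1 <= s -> (forall n, a n.+1 `^ (1 - s / r) <= 1 / 2 ^+ n) ->
  Xp X nX s h.
Proof.
move=> s1 as2; apply/XpE => //.
have s0 : s != 0 by rewrite gt_eqF// (lt_le_trans ltr01).
pose c i := a i.+1 `^ (- (s / r)).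
have [||S [XS _ uS]] := dominated_series
  (u := fun i => ((c i)%:C)%C *: M0_indic mu (G i.+1)) ler01.
- by move=> i; exact: bfsZ.
- move=> i; rewrite bfs_normZ// cabsR ger0_norm ?powR_ge0//.
  apply: le_trans (as2 i); rewrite powRD ?(gt_eqF (a0 i)) ?implybT//.
  by rewrite powRr1 1?mulrC// ltW.
have uE : \forall x \ae mu, forall i,
    cabs (M0_fun (((c i)%:C)%C *: M0_indic mu (G i.+1)) x) =
    c i * \1_(k @^-1` [set i.+1]) x.
  apply: ae_foralln => i.
  apply: filterS2 (M0Z ((c i)%:C)%C (M0_indic mu (G i.+1))) (cabs_indicE mu (G i.+1)).
  by move=> x -> E; rewrite Normc.normcM E cabsR ger0_norm ?powR_ge0.
have [] := Hsolid (g := M0_pow 1 s h) XS; last by [].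
have hE : \forall x \ae mu, h x = ((phi (k x))%:C)%C by exact: M0_classE.
apply: filterS3 (filterI uS uE) hE (cabs_pow1E s h) => x [Sx ux] hx ->.
rewrite hx cabsR ger0_norm//; case kx: (k x) => [|n] /=.
  by rewrite powR0//; exact: cabs_ge0.
apply: le_trans (Sx n.+1); rewrite big_ord_recr/= ux indicE mem_set//= mulr1.
rewrite -powRrM mulNr [_ * s]mulrC lerDr sumr_ge0// => i _; exact: cabs_ge0.
Qed.

(* The pairs [(f, f)] where, for each [j], [f] is a constant multiple of [h] on
   the union of the fibers of [k] over the [n > 0] of 2-adic valuation [j]. *)
Let W : set (M0 * M0)%type := [set fg | [/\ Xp X nX p fg.1, Xp X nX q fg.1,
  fg.2 = fg.1 & exists b : nat -> R[i],
  \forall x \ae mu, fg.1 x = b (logn 2 (k x)) * ((phi (k x))%:C)%C]].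

Let W_subspace : linear_subspace W.
Proof.
split=> [|c [f f'] [g g'] [/= fp fq -> [b fb]] [/= gp gq -> [b' gb]]].
  split=> //=; [exact: Xp0|exact: Xp0|exists (fun=> 0)].
  by apply: filterS (M00 mu) => x ->; rewrite mul0r.
split=> //=; [exact: XpZD|exact: XpZD|exists (fun j => c * b j + b' j)].
apply: filterS3 fb gb (filterI (M0D (c *: f) g) (M0Z c f)) => x fx gx [-> ->].
by rewrite fx gx mulrDl mulrA.
Qed.

(** Provides arbitrarily large indices in block [j], hence sets of arbitrarily small norm. *)
Let block j m : (j = logn 2 (2 ^ j * m.*2.+1) /\ m < 2 ^ j * m.*2.+1)%N.
Proof.
split.
  rewrite lognM ?expn_gt0// pfactorK// logn_coprime ?addn0//.
  by rewrite coprime2n /= odd_double.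
apply: (@leq_trans m.*2.+1); first by rewrite ltnS -addnn leq_addr.
by rewrite leq_pmull// expn_gt0.
Qed.

Let fiber_exp2_gt0 j : (0 < mu (k @^-1` [set (2 ^ j)%N]))%E.
Proof. by rewrite -(prednK (n := 2 ^ j)) ?expn_gt0. Qed.

(** On a set of norm $a$ in block [j], $|ff|^r$ equals $B/a^2$. Solidity gives $B/a \leq C$, that is
    $B \leq Ca$, and $a$ can be taken arbitrarily small along the block, forcing $B \leq 0$. *)
Let W_not_Xr f (b : nat -> R[i]) j : b j != 0 ->
  (\forall x \ae mu, f x = b (logn 2 (k x)) * ((phi (k x))%:C)%C) ->
  ~ Xp X nX r (M0_mul f f).
Proof.
move=> bj fb /XpE Xff.
have {}Xff : X (M0_pow 1 r (M0_mul f f)).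
  by apply: Xff; rewrite (le_trans p1)// ltW.
set C := nX (M0_pow 1 r (M0_mul f f)).
pose B := (cabs (b j) * cabs (b j)) `^ r.
have B0 : 0 < B by rewrite powR_gt0// mulr_gt0// lt0r cabs_ge0 cabs_eq0 bj.
suff : B <= 0 by rewrite leNgt B0.
apply: (cvgr_to_ge (cvg_div_exp2 C)); apply: nearW => m.
have [jE mn] := block j m; move: jE mn; case: (2 ^ j * m.*2.+1)%N => // n jE.
rewrite ltnS => mn.
have C0 : 0 <= C by exact: bfs_ge0.
pose c := B / a n.+1 / a n.+1.
have c0 : 0 <= c by rewrite !divr_ge0// ltW.
have [|_] := Hsolid (g := (c%:C)%C *: M0_indic mu (G n.+1)) Xff.
  apply: filterS3 (filterI fb (M0_mulE f f)) (cabs_pow1E r (M0_mul f f))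
    (filterI (M0Z (c%:C)%C (M0_indic mu (G n.+1))) (cabs_indicE mu (G n.+1))).
  move=> x [fx ffx] -> [-> Gx]; rewrite Normc.normcM Gx ffx cabsR ger0_norm//.
  rewrite indicE; case: (boolP (x \in _)) => [|_]; last by rewrite mulr0 powR_ge0.
  rewrite inE /= => kx; rewrite mulr1 fx kx -jE !Normc.normcM cabsR ger0_norm//=.
  rewrite mulrACA [leRHS]powRM ?mulr_ge0 ?cabs_ge0 ?powR_ge0//.
  rewrite [X in _ * X]powRM ?powR_ge0// -powRrM mulNr mulVf ?gt_eqF//.
  - by rewrite powR_inv1 ?(ltW (a0 n))// mulrA.
  - exact: powR_ge0.
rewrite bfs_normZ// cabsR ger0_norm// -/(a n.+1) divfK ?gt_eqF// -/C => BC.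
apply: (@le_trans _ _ (C * a n.+1)); first by rewrite -ler_pdivrMr.
rewrite ler_wpM2l//; apply: le_trans (a_le n) _.
rewrite div1r lef_pV2 ?posrE ?exprn_gt0//.
by rewrite ler_weXn2l ?ler1n.
Qed.

Let W_closed : closed_in (Xprod X nX p q) (Xprod_norm X nX p q) W.
Proof.
move=> u [f g] Wu [/= fp gq] ufg.
(* Indices [s n] with distance to the limit below $2^{-n}$, which yields almost everywhere
   convergence in both coordinates. *)
have [|s sP] := @boolp.choice _ _ (fun n j =>
    Xprod_norm X nX p q (u j - (f, g)) < 1 / 2 ^+ n).
  move=> n; have /cvgrPdist_lt/(_ (1 / 2 ^+ n))[|N _ /(_ N (leqnn N))] := ufg.
    by rewrite divr_gt0// exprn_gt0.
  by rewrite /= sub0r normrN => /(le_lt_trans (ler_norm _)) ?; exists N.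
have u2E n : (u n).2 = (u n).1 by have [] := Wu n.
have [|b ub] := @boolp.choice _ _ (fun n (b : nat -> R[i]) =>
    \forall x \ae mu, M0_fun (u n).1 x = b (logn 2 (k x)) * ((phi (k x))%:C)%C).
  by move=> n; have [] := Wu n.
have fcvg : \forall x \ae mu,
    (fun n => cabs (M0_fun ((u (s n)).1 - f) x)) @ \oo --> (0 : R).
  apply: (@ae_cvg_of_fast_pnorm_cvg p (fun n => (u (s n)).1 - f)) => // n.
    by apply: XpB => //; have [] := Wu (s n).
  by have := sP n; rewrite /Xprod_norm gt_max => /andP[].
have gcvg : \forall x \ae mu,
    (fun n => cabs (M0_fun ((u (s n)).1 - g) x)) @ \oo --> (0 : R).
  apply: (@ae_cvg_of_fast_pnorm_cvg q (fun n => (u (s n)).1 - g)) => // n.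
    by apply: XpB => //; have [] := Wu (s n).
  by have := sP n; rewrite /Xprod_norm gt_max -u2E => /andP[].
pose z n x := b (s n) (logn 2 (k x)) * ((phi (k x))%:C)%C.
(* Both coordinates of [u (s n)] equal [z n] almost everywhere, so the two limits agree. *)
have good : \forall x \ae mu,
    ((fun n => cabs (z n x - M0_fun f x)) @ \oo --> (0 : R)) /\
    M0_fun g x = M0_fun f x.
  have uE : \forall x \ae mu, forall n,
      [/\ M0_fun ((u (s n)).1 - f) x = z n x - M0_fun f x &
      M0_fun ((u (s n)).1 - g) x = z n x - M0_fun g x].
    apply: ae_foralln => n.
    apply: filterS3 (ub (s n)) (M0B (u (s n)).1 f) (M0B (u (s n)).1 g).
    by move=> x ux -> ->; rewrite /z -ux.
  apply: filterS3 uE fcvg gcvg => x ux.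
  rewrite (_ : (fun n => _) = (fun n => cabs (z n x - M0_fun f x))); last first.
    by apply/funext => n; have [->] := ux n.
  rewrite (_ : (fun n => cabs (M0_fun (_ - g) x)) =
    (fun n => cabs (z n x - M0_fun g x))); last first.
    by apply/funext => n; have [_ ->] := ux n.
  move=> fx gx; split=> //; rewrite -[M0_fun f x]mul1r.
  by apply: (cabs_cvg_unique fx); under eq_fun do rewrite mul1r.
(* A point of convergence [y j] in the fiber over [2 ^ j] represents block [j]; the value of [f]
   there determines the limit coefficient. *)
have [|y yP] := @boolp.choice _ _ (fun j x => k x = (2 ^ j)%N /\
    ((fun n => cabs (z n x - M0_fun f x)) @ \oo --> (0 : R))).
  by move=> j; have [x kx [zx _]] := ae_exists (mk _) (fiber_exp2_gt0 j) good; exists x.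
have gf : g = f by apply/M0_eqP; apply: filterS good => x [].
rewrite {}gf in gq *; split => //=.
exists (fun j => M0_fun f (y j) / ((phi (2 ^ j))%:C)%C).
apply: filterS good => x [zx _]; set j := logn 2 (k x).
have [ky zy] := yP j.
have phij : ((phi (2 ^ j))%:C)%C != 0 :> R[i].
  by rewrite fmorph_eq0 gt_eqF// phi_gt0// expn_gt0.
(* On the block of [y j], [z n x] is [z n (y j)] times the fixed ratio [phi (k x) / phi (2 ^ j)]. *)
rewrite -mulrA mulrC; apply: (cabs_cvg_unique zy).
rewrite (_ : (fun n => _) = (fun n => cabs (z n x - M0_fun f x)))//.
apply/funext => n; congr (cabs (_ - _)).
by rewrite /z ky pfactorK// -/j [LHS]mulrC [LHS]mulrA mulfK.
Qed.

(** The restrictions [hj] of $h$ to the blocks give elements of [W]. If [n] vectors spanned [W],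
    expanding [n.+1] of these would factor the identity matrix of size [n.+1] through dimension
    [n]. *)
Let W_infinite : ~ finite_dimensional W.
Proof.
move=> [n [B [WB span]]].
have [|b Bb] := @boolp.choice _ _ (fun i (b : nat -> R[i]) =>
    \forall x \ae mu, M0_fun (B i).1 x = b (logn 2 (k x)) * ((phi (k x))%:C)%C).
  by move=> i; have [] := WB i.
pose hj j : M0 := M0_class mu (cmeasurable_real (measurable_comp_nat
  (fun m => (logn 2 m == j)%:R * phi m) mk)).
have hjE j : \forall x \ae mu,
    hj j x = (((logn 2 (k x) == j)%:R * phi (k x))%:C)%C by exact: M0_classE.
have hjh j : \forall x \ae mu, cabs (hj j x) <= cabs (h x).
  have hE : \forall x \ae mu, h x = ((phi (k x))%:C)%C by exact: M0_classE.
  apply: filterS2 (hjE j) hE => x -> ->; rewrite !cabsR !ger0_norm ?mulr_ge0//.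
  by rewrite ler_piMl//; case: eqP.
have Whj j : W (hj j, hj j).
  split => //=.
  - by apply: (Xp_solid p1 _ (hjh j)); exact: Xp_h.
  - by apply: (Xp_solid q1 _ (hjh j)); exact: Xp_h.
  exists (fun l => (l == j)%:R).
  by apply: filterS (hjE j) => x ->; rewrite rmorphM/= rmorph_nat.
have [|c hc] := @boolp.choice _ _ (fun (j : nat) (c : 'I_n -> R[i]) =>
  (hj j, hj j) = \sum_(i < n) c i *: B i).
  by move=> j; exact: span.
(* Evaluate the expansion of [hj j] at a point of the fiber over [2 ^ l] and cancel the nonzero
   value of $h$. *)
have cb j l : \sum_(i < n) c j i * b i l = (l == j)%:R.
  have BbA : \forall x \ae mu, forall i, 
      M0_fun (c j i *: (B i).1) x =
        c j i * (b i (logn 2 (k x)) * ((phi (k x))%:C)%C).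
    apply: filter_forall => i.
    by apply: filterS2 (Bb i) (M0Z (c j i) (B i).1) => x <- ->.
  have := M0_sum (index_enum 'I_n) (fun i => c j i *: (B i).1).
  have -> : \sum_(i < n) c j i *: (B i).1 = hj j.
    have /(congr1 fst) /= -> := hc j.
    by rewrite raddf_sum.
  move=> sE.
  have [x kx [[hx Bx] sx]] := ae_exists (mk _) (fiber_exp2_gt0 l)
    (filterI (filterI (hjE j) BbA) sE).
  have phil : ((phi (2 ^ l))%:C)%C != 0 :> R[i].
    by rewrite fmorph_eq0 gt_eqF// phi_gt0// expn_gt0.
  apply: (mulIf phil); rewrite mulr_suml.
  move: sx; rewrite hx kx pfactorK// rmorphM/= rmorph_nat => ->.
  by apply: eq_bigr => i _; rewrite Bx kx pfactorK// mulrA.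
have /mulmx1_min : (\matrix_(j < n.+1, i < n) c j i) *m
    (\matrix_(i < n, l < n.+1) b i l) = 1%:M.
  apply/matrixP => j l; rewrite !mxE; under eq_bigr do rewrite !mxE.
  by rewrite cb eq_sym.
by rewrite ltnn.
Qed.

Lemma spaceable_of_small_fibers :
  spaceable (Xprod X nX p q) (Xprod_norm X nX p q)
    [set fg | Xprod X nX p q fg /\ ~ Xp X nX r (M0_mul fg.1 fg.2)].
Proof.
exists W; split=> //.
  by move=> [f g] [/= fp fq -> _].
move=> [f g] [/= fp fq -> [b fb]].
(* Either some coefficient is nonzero, or [f] vanishes almost everywhere. *)
have [[j bj]|b0] := pselect (exists j, b j != 0).
  by left; split => //=; exact: (W_not_Xr bj fb).
right; suff -> : f = 0 by [].
apply/M0_eqP; apply: filterS2 fb (M00 mu) => x -> ->.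
have /negP/negPn/eqP -> : ~ (b (logn 2 (k x)) != 0).
  by move=> bx; apply: b0; eexists; exact: bx.
by rewrite mul0r.
Qed.

End block_constant_multiples.

End solid_spaces.

(** * Choice of the norm bounds and conclusion *)

Theorem theorem4p4 (R : realType) (d : measure_display) (T : measurableType d)
    (mu : {sigma_finite_measure set T -> \bar R})
    (X : set (M0 mu)) (nX : M0 mu -> R)
    (HX : banach_function_space X nX) (Hsolid : solid X nX)
    (Hinf : ereal_inf [set (nX (M0_indic mu E))%:E | E in A0 X] = 0%E) :
  forall p q r : R, 1 <= p -> p < r -> 1 <= q -> q < r ->
    spaceable (Xprod X nX p q) (Xprod_norm X nX p q)
      [set fg | Xprod X nX p q fg /\ ~ Xp X nX r (M0_mul fg.1 fg.2)].
Proof.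
move=> p q r p1 pr q1 qr.
have exponent_gt0 s : 1 <= s -> s < r -> 0 < 1 - s / r.
  move=> s1 sr; have r0 : 0 < r by rewrite (lt_trans _ sr)// (lt_le_trans ltr01).
  by rewrite subr_gt0 ltr_pdivrMr// mul1r.
have e2 n : 0 < 1 / 2 ^+ n :> R by rewrite divr_gt0// exprn_gt0.
have powle (x e s : R) : 0 <= x -> 0 < e -> 0 < s -> x <= e `^ s^-1 -> x `^ s <= e.
  move=> x0 ee s0 xe; rewrite -[leRHS]powRr1 ?(ltW ee)// -(mulVf (lt0r_neq0 s0)).
  by rewrite powRrM ge0_ler_powR ?nnegrE ?powR_ge0// ltW.
(* The last two terms are the thresholds below which $x^{1-p/r}$ and $x^{1-q/r}$ are at most
   $2^{-n}$; both exponents are positive. *)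
pose delta n := Num.min (1 / 2 ^+ n) (Num.min ((1 / 2 ^+ n) `^ (1 - p / r)^-1)
  ((1 / 2 ^+ n) `^ (1 - q / r)^-1)).
have [|k [mk kP]] := exists_disjoint_small_sets HX Hsolid (delta := delta) _ Hinf.
  by move=> n; rewrite !lt_min e2 !powR_gt0.
apply: (spaceable_of_small_fibers HX Hsolid p1 pr q1 (mk := mk)) => n;
  have [k0 kX] := kP n => //; rewrite !le_min => /and3P[d1 d2 d3] //.
- by apply: powle => //; [exact: (bfs_ge0 HX)|exact: exponent_gt0].
- by apply: powle => //; [exact: (bfs_ge0 HX)|exact: exponent_gt0].
Qed.
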